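(* Let $n\ge 2$ be an integer and let $g\in\operatorname{BS}(1,n)$ be a non-trivial element. Then $e\text{-}\operatorname{Stab}(g)$ is an infinitely generated submonoid of $\operatorname{End}(\operatorname{BS}(1,n))$, i.e. it is a submonoid that is not finitely generated as a monoid.
   Context: $\operatorname{BS}(1,n)=\langle a,t\mid tat^{-1}=a^n\rangle$. $\operatorname{End}(G)$ is the monoid of endomorphisms of a group $G$ under composition. For $g\in G$, $e\text{-}\operatorname{Stab}(g)=\{\varphi\in\operatorname{End}(G)\mid\varphi(g)=g\}$. *)

(* Defs.v *)
From HB Require Import structures.
From mathcomp Require Import all_boot.
From mathcomp Require Import boolp classical_sets cardinality.

Set Implicit Arguments.
Unset Strict Implicit.
Unset Printing Implicit Defensive.

Local Open Scope classical_set_scope.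
Local Open Scope quotient_scope.
Local Open Scope group_scope.

(* The letter (x, false) stands for the generator x and (x, true) for its
   formal inverse. *)
Definition word (X : Type) := seq (X * bool).

Definition letter_inv (X : Type) (l : X * bool) : X * bool := (l.1, ~~ l.2).

Definition word_inv (X : Type) (w : word X) : word X :=
  rev (map (@letter_inv X) w).

Section PresentedGroup.
Variables (X : choiceType) (R : word X -> word X -> Prop).

(* The smallest congruence on words that contains R and identifies
   x x^-1 and x^-1 x with the empty word. *)
Inductive pres_cong : word X -> word X -> Prop :=
| pres_refl u : pres_cong u u
| pres_sym u v : pres_cong u v -> pres_cong v u
| pres_trans u v w : pres_cong u v -> pres_cong v w -> pres_cong u w
| pres_cat u u' v v' :
    pres_cong u u' -> pres_cong v v' -> pres_cong (u ++ v) (u' ++ v')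
| pres_cancel l : pres_cong [:: l; letter_inv l] [::]
| pres_rel u v : R u v -> pres_cong u v.

Definition pres_congb (u v : word X) : bool := `[< pres_cong u v >].

Lemma pres_congb_equiv : equiv_class_of pres_congb.
Proof.
split=> [u | u v | v u w].
- by apply/asboolP; exact: pres_refl.
- by apply/asboolP/asboolP; exact: pres_sym.
- by move=> /asboolP uv /asboolP vw; apply/asboolP; exact: pres_trans vw.
Qed.

Canonical pres_congb_rel := EquivRelPack pres_congb_equiv.

(* The group <X | u = v for all u, v with R u v>. *)
Definition presented := {eq_quot pres_congb}.
HB.instance Definition _ := Choice.on presented.
HB.instance Definition _ := EqQuotient.on presented.

Definition pres_class (w : word X) : presented := \pi_presented w.

Lemma pres_classP u v : pres_class u = pres_class v <-> pres_cong u v.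
Proof.
split=> [/eqP | uv].
  by rewrite /pres_class piE => /asboolP.
by apply/eqP; rewrite /pres_class piE; apply/asboolP.
Qed.

Lemma pres_class_surj (x : presented) : exists w, x = pres_class w.
Proof. by exists (repr x); rewrite /pres_class reprK. Qed.

Lemma letter_invK : involutive (@letter_inv X).
Proof. by case=> x b; rewrite /letter_inv /= negbK. Qed.

Lemma word_invK : involutive (@word_inv X).
Proof.
by move=> w; rewrite /word_inv map_rev revK mapK //; exact: letter_invK.
Qed.

Lemma word_inv_cat (u v : word X) : word_inv (u ++ v) = word_inv v ++ word_inv u.
Proof. by rewrite /word_inv map_cat rev_cat. Qed.

Lemma pres_mulwV w : pres_cong (w ++ word_inv w) [::].
Proof.
elim: w => [|l w IH]; first exact: pres_refl.
rewrite -cat1s word_inv_cat -catA (catA w).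
apply: pres_trans (pres_cancel l).
rewrite -[[:: l; _]]cat1s; apply: (pres_cat (pres_refl _)).
rewrite -[[:: letter_inv l]]cat0s; apply: pres_cat => //; exact: pres_refl.
Qed.

Lemma pres_mulVw w : pres_cong (word_inv w ++ w) [::].
Proof. by rewrite -{2}(word_invK w); exact: pres_mulwV. Qed.

Lemma pres_cong_inv u v : pres_cong u v -> pres_cong (word_inv u) (word_inv v).
Proof.
move=> uv; apply: (@pres_trans _ (word_inv u ++ (v ++ word_inv v))).
  rewrite -{1}[word_inv u]cats0; apply: pres_cat; first exact: pres_refl.
  exact/pres_sym/pres_mulwV.
rewrite catA -{2}[word_inv v]cat0s; apply: pres_cat; last exact: pres_refl.
apply: pres_trans (pres_mulVw u); apply: pres_cat; first exact: pres_refl.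
exact: pres_sym.
Qed.

Definition pres_mul (x y : presented) : presented :=
  pres_class (repr x ++ repr y).
Definition pres_one : presented := pres_class [::].
Definition pres_inv (x : presented) : presented :=
  pres_class (word_inv (repr x)).

Lemma pres_cong_repr w : pres_cong (repr (pres_class w)) w.
Proof. by apply/pres_classP; rewrite /pres_class reprK. Qed.

Lemma pres_mulE u v : pres_mul (pres_class u) (pres_class v) = pres_class (u ++ v).
Proof. by apply/pres_classP; apply: pres_cat; exact: pres_cong_repr. Qed.

Lemma pres_invE u : pres_inv (pres_class u) = pres_class (word_inv u).
Proof. by apply/pres_classP; apply: pres_cong_inv; exact: pres_cong_repr. Qed.

Lemma pres_mulgA : associative pres_mul.
Proof.
move=> x y z; have [u ->] := pres_class_surj x.
have [v ->] := pres_class_surj y; have [w ->] := pres_class_surj z.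
by rewrite !pres_mulE catA.
Qed.

Lemma pres_mul1g : left_id pres_one pres_mul.
Proof. by move=> x; have [u ->] := pres_class_surj x; rewrite pres_mulE. Qed.

Lemma pres_mulg1 : right_id pres_one pres_mul.
Proof.
by move=> x; have [u ->] := pres_class_surj x; rewrite pres_mulE cats0.
Qed.

Lemma pres_mulVg : left_inverse pres_one pres_inv pres_mul.
Proof.
move=> x; have [u ->] := pres_class_surj x; rewrite pres_invE pres_mulE.
by apply/pres_classP; exact: pres_mulVw.
Qed.

Lemma pres_mulgV : right_inverse pres_one pres_inv pres_mul.
Proof.
move=> x; have [u ->] := pres_class_surj x; rewrite pres_invE pres_mulE.
by apply/pres_classP; exact: pres_mulwV.
Qed.

HB.instance Definition _ := isGroup.Build presented
  pres_mulgA pres_mul1g pres_mulg1 pres_mulVg pres_mulgV.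

Definition pres_gen (x : X) : presented := pres_class [:: (x, false)].

Lemma pres_class_cat u v : pres_class (u ++ v) = pres_class u * pres_class v.
Proof. exact/esym/pres_mulE. Qed.

Lemma pres_class_inv u : pres_class (word_inv u) = (pres_class u)^-1.
Proof. exact/esym/pres_invE. Qed.

Lemma pres_class_nseq n l : pres_class (nseq n l) = pres_class [:: l] ^+ n.
Proof.
by elim: n => [|n IH] //; rewrite expgS -IH -pres_class_cat.
Qed.

Definition word_eval (G : groupType) (f : X -> G) (w : word X) : G :=
  foldr (fun l y => (if l.2 then (f l.1)^-1 else f l.1) * y) 1 w.

Lemma word_eval_cat (G : groupType) (f : X -> G) u v :
  word_eval f (u ++ v) = word_eval f u * word_eval f v.
Proof. by elim: u => [|l u IH] /=; rewrite ?mul1g // IH mulgA. Qed.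

Lemma word_eval_gen w : word_eval pres_gen w = pres_class w.
Proof.
elim: w => [|[x b] w IH] //=; rewrite IH -[_ :: w]cat1s pres_class_cat.
by case: b => //=; rewrite -pres_class_inv.
Qed.

Lemma word_eval_cong (G : groupType) (f : X -> G) :
  (forall u v, R u v -> word_eval f u = word_eval f v) ->
  forall u v, pres_cong u v -> word_eval f u = word_eval f v.
Proof.
move=> fR u v; elim=> {u v} //.
- by move=> u v w _ -> _ ->.
- by move=> u u' v v' _ e1 _ e2; rewrite !word_eval_cat e1 e2.
- by case=> x [] /=; rewrite mulg1 ?mulVg ?mulgV.
Qed.

Section UniversalProperty.
Variables (G : groupType) (f : X -> G).
Hypothesis fR : forall u v, R u v -> word_eval f u = word_eval f v.

(* The unused hypothesis is an argument so that the morphism instance below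
   can be inferred from the term. *)
Definition presented_lift
    of (forall u v, R u v -> word_eval f u = word_eval f v) :=
  fun x : presented => word_eval f (repr x).

Lemma presented_lift_class w : presented_lift fR (pres_class w) = word_eval f w.
Proof. by apply: (word_eval_cong fR); exact: pres_cong_repr. Qed.

Fact presented_lift_morphism : monoid_morphism (presented_lift fR).
Proof.
split=> [|x y]; first exact: (presented_lift_class [::]).
have [u ->] := pres_class_surj x; have [v ->] := pres_class_surj y.
by rewrite -pres_class_cat !presented_lift_class word_eval_cat.
Qed.

HB.instance Definition _ := isUMagmaMorphism.Build presented G
  (presented_lift fR) presented_lift_morphism.

Lemma presented_lift_gen x : presented_lift fR (pres_gen x) = f x.
Proof. by rewrite presented_lift_class /= mulg1. Qed.

End UniversalProperty.

Lemma presented_morphism_ext (G : groupType)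
    (g h : UMagmaMorphism.type presented G) :
  (forall x, g (pres_gen x) = h (pres_gen x)) -> g =1 h.
Proof.
move=> gh x; have [w ->] := pres_class_surj x; elim: w => [|[y b] w IH].
  by rewrite -[pres_class _]/(1%g : presented) !gmulf1.
rewrite -cat1s pres_class_cat !gmulfM IH; congr (_ * _).
case: b; last exact: gh.
by rewrite -[[:: _]]/(word_inv [:: (y, false)]) pres_class_inv !gmulfV gh.
Qed.

End PresentedGroup.

Inductive bs_gen := bs_gen_a | bs_gen_t.

Definition bool_of_bs_gen (x : bs_gen) : bool :=
  if x is bs_gen_t then true else false.
Definition bs_gen_of_bool (b : bool) : bs_gen :=
  if b then bs_gen_t else bs_gen_a.
Lemma bool_of_bs_genK : cancel bool_of_bs_gen bs_gen_of_bool.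
Proof. by case. Qed.

HB.instance Definition _ := Choice.copy bs_gen (can_type bool_of_bs_genK).

(* t a t^-1 = a^n *)
Definition bs_relation (n : nat) (u v : word bs_gen) : Prop :=
  u = [:: (bs_gen_t, false); (bs_gen_a, false); (bs_gen_t, true)] /\
  v = nseq n (bs_gen_a, false).

(* BS(1, n) = <a, t | t a t^-1 = a^n> *)
Definition BS1 (n : nat) := presented (bs_relation n).
HB.instance Definition _ n := Group.on (BS1 n).

Definition bs_a n : BS1 n := pres_gen (bs_relation n) bs_gen_a.
Definition bs_t n : BS1 n := pres_gen (bs_relation n) bs_gen_t.

Lemma bs_relationE n : bs_t n * bs_a n * (bs_t n)^-1 = bs_a n ^+ n.
Proof.
pose wt := [:: (bs_gen_t, false)]; pose wa := [:: (bs_gen_a, false)].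
transitivity (pres_class (bs_relation n) ((wt ++ wa) ++ word_inv wt)).
  by rewrite !pres_class_cat pres_class_inv.
transitivity (pres_class (bs_relation n) (nseq n (bs_gen_a, false))).
  by apply/pres_classP; exact: pres_rel.
exact: pres_class_nseq.
Qed.

Section Submonoids.
Variable M : monoidType.

Definition submonoid (S : set M) : Prop := monoid_closed [in S].

Lemma submonoidE (S : set M) :
  submonoid S <-> S 1 /\ forall x y, S x -> S y -> S (x * y).
Proof.
split=> [[S1 SM]|[S1 SM]].
  split=> [|x y Sx Sy]; first by apply/set_mem; exact: S1.
  by apply/set_mem; apply: SM; exact: mem_set.
split=> [|x y /set_mem Sx /set_mem Sy]; first exact: mem_set.
by apply/mem_set; exact: SM.
Qed.

Definition submonoid_gen (A : set M) : set M := smallest submonoid A.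

(* Finite generation as a monoid. *)
Definition finitely_generated (S : set M) : Prop :=
  exists2 A : set M, finite_set A & S = submonoid_gen A.

End Submonoids.

(* End(G): a map of groups that preserves products and 1 is exactly a group
   homomorphism. *)
Definition endo (G : groupType) := UMagmaMorphism.type G G.

Section EndomorphismMonoid.
Variable G : groupType.
Implicit Types phi psi : endo G.

Definition endo_comp phi psi : endo G := phi \o psi.
Definition endo_id : endo G := idfun.

Lemma endo_ext phi psi : phi =1 psi -> phi = psi.
Proof.
case: phi => f [[f1] [fM]]; case: psi => g [[g1] [gM]] /= /funext fg.
rewrite /= in fg; case: _ / fg in g1 gM *.
by rewrite (Prop_irrelevance f1 g1) (Prop_irrelevance fM gM).
Qed.

Lemma endo_compA : associative endo_comp.
Proof. by move=> phi psi chi; apply: endo_ext. Qed.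

Lemma endo_comp1 : right_id endo_id endo_comp.
Proof. by move=> phi; apply: endo_ext. Qed.

Lemma endo_1comp : left_id endo_id endo_comp.
Proof. by move=> phi; apply: endo_ext. Qed.

HB.instance Definition _ := gen_eqMixin (endo G).
HB.instance Definition _ := gen_choiceMixin (endo G).
HB.instance Definition _ :=
  isMonoid.Build (endo G) endo_compA endo_1comp endo_comp1.

Definition e_Stab (g : G) : set (endo G) := [set phi : endo G | phi g = g].

End EndomorphismMonoid.

(* Main.v *)
(** BS(1, n) embeds into the affine group of the rationals, an element (x, k)
    acting by y |-> n ^ k y + x with x in Z[1/n].  An endomorphism fixing some
    g <> 1 sends a to (alpha, 0) and t to (beta, 1), so it acts by
      (x, k) |-> (alpha x + beta (n ^ k - 1) / (n - 1), k).
    If g = (x, 0), this fixes g iff alpha = 1, and the stabiliser is the additive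
    group Z[1/n], which is not finitely generated.  If g = (x, k) with k <> 0,
    then alpha determines beta and takes, among others, all the values
    1 + c (n ^ k - 1) / (n - 1) with c in Z[1/n]; the numerators of these have
    infinitely many prime divisors, while alpha is multiplicative. *)

Require Import Defs.
From HB Require Import structures.
From mathcomp Require Import all_boot.
From mathcomp Require Import all_order all_algebra.
From mathcomp Require Import boolp classical_sets cardinality.
From mathcomp Require Import ring zify.

Set Implicit Arguments.
Unset Strict Implicit.
Unset Printing Implicit Defensive.

Import Order.TTheory GRing.Theory Num.Theory.

Local Open Scope group_scope.

(** * Word induction and a criterion for infinite generation *)

Lemma presented_word_ind (X : choiceType) (R : word X -> word X -> Prop)
    (P : presented R -> Prop) :
  P 1 -> (forall x h, P h -> P (pres_gen R x * h)) ->
  (forall x h, P h -> P ((pres_gen R x)^-1 * h)) -> forall h, P h.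
Proof.
move=> P1 PM PV h; have [w ->] := pres_class_surj h; rewrite -word_eval_gen.
by elim: w => [|[x []] w IH] //=; [exact: PV | exact: PM].
Qed.

Lemma e_Stab_submonoid (G : groupType) (g : G) : submonoid (e_Stab g).
Proof.
apply/submonoidE; split=> // phi psi phi_g psi_g.
by rewrite /e_Stab /= psi_g.
Qed.

(** If [A] generated [S], then [T] would contain all of [S]. *)
Lemma not_finitely_generated (M : monoidType) (S : set M) :
  (forall A, finite_set A -> (A `<=` S)%classic -> exists T,
    [/\ submonoid T, (A `<=` T)%classic & ~ (S `<=` T)%classic]) ->
  ~ finitely_generated S.
Proof.
move=> noT [A finA SA]; have AS : (A `<=` S)%classic.
  by rewrite SA; exact: sub_gen_smallest.
have [T [TM AT []]] := noT A finA AS.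
by rewrite SA; exact: smallest_sub.
Qed.

Lemma finite_common_multiple (T : choiceType) (A : set T) (f : T -> nat) :
  finite_set A -> (forall x, 0 < f x)%N ->
  exists2 Q, (0 < Q)%N & forall x, A x -> (f x %| Q)%N.
Proof.
move=> /finite_seqP [s ->] f_gt0; exists (\prod_(x <- s) f x)%N.
  by rewrite prodn_gt0.
by move=> x /= xs; rewrite (big_rem x) //= dvdn_mulr.
Qed.

(** * Affine maps of the rationals with linear part a power of the base *)

Section Affine.
Variable n : nat.

(* The pair (x, k) stands for the affine map y |-> n.+1 ^ k * y + x of the
   rationals. *)
Definition affine : Type := (rat * int)%type.
HB.instance Definition _ := Choice.on affine.

Definition base : rat := n.+1%:R%R.

Lemma base_neq0 : (base != 0)%R.
Proof. by rewrite pnatr_eq0. Qed.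

Definition affine_mul (x y : affine) : affine :=
  (x.1 + base ^ x.2 * y.1, x.2 + y.2)%R.
Definition affine_one : affine := (0, 0)%R.
Definition affine_inv (x : affine) : affine := (- (base ^ (- x.2) * x.1), - x.2)%R.

Fact affine_mulA : associative affine_mul.
Proof.
move=> [x k] [y l] [z m]; rewrite /affine_mul /= addrA; congr pair.
by rewrite expfzDr ?base_neq0 // mulrDr mulrA addrA.
Qed.

Fact affine_mul1 : left_id affine_one affine_mul.
Proof. by case=> x k; rewrite /affine_mul /= expr0z mul1r !add0r. Qed.

Fact affine_mulr1 : right_id affine_one affine_mul.
Proof. by case=> x k; rewrite /affine_mul /= mulr0 !addr0. Qed.

Fact affine_mulV : left_inverse affine_one affine_inv affine_mul.
Proof. by case=> x k; rewrite /affine_mul /= !addNr. Qed.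

Fact affine_mulrV : right_inverse affine_one affine_inv affine_mul.
Proof.
case=> x k; rewrite /affine_mul /= mulrN mulrA -expfzDr ?base_neq0 //.
by rewrite subrr expr0z mul1r subrr.
Qed.

HB.instance Definition _ := isGroup.Build affine
  affine_mulA affine_mul1 affine_mulr1 affine_mulV affine_mulrV.

Lemma affine_mulE (x y : affine) :
  x * y = (x.1 + base ^ x.2 * y.1, x.2 + y.2)%R.
Proof. by []. Qed.

Lemma affine_invE (x : affine) : x^-1 = (- (base ^ (- x.2) * x.1), - x.2)%R.
Proof. by []. Qed.

Lemma affine_expE x k : ((x, 0%R) : affine) ^+ k = (x *+ k, 0)%R.
Proof.
elim: k => [|k IH]; first by rewrite mulr0n.
by rewrite expgS IH affine_mulE /= expr0z mul1r mulrS addr0.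
Qed.

Lemma affine_exp2 (x : affine) k : (x ^+ k).2 = (x.2 *+ k)%R.
Proof.
elim: k => [|k IH]; first by rewrite mulr0n.
by rewrite expgS affine_mulE /= IH mulrS.
Qed.

(* The geometric sum 1 + base + ... + base ^ (k - 1), extended to k < 0. *)
Definition geom (k : int) : rat := ((base ^ k - 1) / (base - 1))%R.

(** For base > 1 and nonzero [alpha], this is conjugation by y |-> alpha y - beta / (base - 1). *)
Definition affine_act (alpha beta : rat) (x : affine) : affine :=
  (alpha * x.1 + beta * geom x.2, x.2)%R.

Lemma affine_act_morphism alpha beta :
  monoid.monoid_morphism (affine_act alpha beta).
Proof.
split.
  change (affine_act alpha beta affine_one = affine_one).
  by rewrite /affine_act /geom /= expr0z subrr mul0r !mulr0 addr0.
move=> [x k] [y l]; rewrite !affine_mulE /affine_act /geom /=; congr pair.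
rewrite expfzDr ?base_neq0 //; ring.
Qed.
HB.instance Definition _ alpha beta := isUMagmaMorphism.Build affine affine
  (affine_act alpha beta) (affine_act_morphism alpha beta).

(** With [l = 1] this is the projection to the exponent, kept inside [affine]. *)
Definition affine_shift (l : int) (x : affine) : affine := (0, l * x.2)%R.

Lemma affine_shift_morphism l : monoid.monoid_morphism (affine_shift l).
Proof.
split.
  change (affine_shift l affine_one = affine_one).
  by rewrite /affine_shift /= mulr0.
move=> x y; rewrite !affine_mulE /affine_shift /=; congr pair.
  by rewrite mulr0 addr0.
by rewrite mulrDr.
Qed.
HB.instance Definition _ l := isUMagmaMorphism.Build affine affine
  (affine_shift l) (affine_shift_morphism l).

(** * The representation of BS(1, n + 1) by affine maps *)

Definition affine_gen (x : bs_gen) : affine :=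
  if x is bs_gen_t then (0, 1)%R else (1, 0)%R.

Lemma affine_gen_rel u v : bs_relation n.+1 u v ->
  word_eval affine_gen u = word_eval affine_gen v.
Proof.
case=> -> ->; transitivity (((1, 0)%R : affine) ^+ n.+1); last first.
  by elim: n.+1 => [|k IH] //=; rewrite expgS IH.
rewrite affine_expE /= mulg1 affine_invE !affine_mulE /=.
by rewrite !(mulr0, expr1z, expr0z, oppr0, addr0, mulr1, add0r, subrr).
Qed.

Definition rho : BS1 n.+1 -> affine := presented_lift affine_gen_rel.
HB.instance Definition _ := UMagmaMorphism.on rho.

Local Notation a := (bs_a n.+1).
Local Notation t := (bs_t n.+1).

Lemma rho1 : rho 1 = (0, 0)%R. Proof. exact: (presented_lift_class _ [::]). Qed.
Lemma rhoM : {morph rho : x y / x * y}. Proof. exact: gmulfM. Qed.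
Lemma rhoV : {morph rho : x / x^-1}. Proof. exact: gmulfV. Qed.
Lemma rhoX k : {morph rho : x / x ^+ k}. Proof. exact: gmulfXn. Qed.
Lemma rho_a : rho a = (1, 0)%R. Proof. exact: presented_lift_gen. Qed.
Lemma rho_t : rho t = (0, 1)%R. Proof. exact: presented_lift_gen. Qed.

Lemma mul_t_aX p : t * a ^+ p = a ^+ (n.+1 * p) * t.
Proof.
have conj_t x : t * x * t^-1 = x ^ t^-1 by rewrite conjgE invgK mulgA.
by rewrite expgnA -bs_relationE conj_t -conjXg -conj_t mulgVK.
Qed.

Lemma mul_tX_a i : t ^+ i * a = a ^+ (n.+1 ^ i) * t ^+ i.
Proof.
elim: i => [|i IH]; first by rewrite mulg1 mul1g.
by rewrite expgS -mulgA IH mulgA mul_t_aX -expnS -mulgA.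
Qed.

(** Such products are stable under left multiplication by generators and their inverses; [p] and [q]
    encode the integer exponent q - p. *)
Lemma BS1_normal_form (h : BS1 n.+1) : exists i p q j,
  h = t ^- i * a ^- p * a ^+ q * t ^+ j.
Proof.
elim/presented_word_ind: h => [|x h|x h].
- by exists 0, 0, 0, 0; rewrite !expg0 invg1 !mulg1.
- move=> [i [p [q [j ->]]]]; case: x; rewrite -/(bs_a _) -/(bs_t _).
    exists i, p, (n.+1 ^ i + q), j; rewrite !mulgA; congr (_ * _).
    have -> : a * t ^- i = t ^- i * a ^+ (n.+1 ^ i).
      by apply: (@mulgI _ (t ^+ i)); rewrite !mulgA mul_tX_a mulgV mul1g mulgK.
    rewrite expgnDr !mulgA; congr (_ * _); rewrite -!mulgA; congr (_ * _).
    by apply: commuteV; apply: commute_sym; apply: commuteX2; apply: commute_refl.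
  (* [t] cancels against [t ^- i] unless [i = 0]; then it moves right, multiplying [p] and [q] by
     [n.+1]. *)
  case: i => [|i].
    exists 0, (n.+1 * p)%N, (n.+1 * q)%N, j.+1.
    rewrite expg0 invg1 !mul1g !mulgA.
    have -> : t * a ^- p = a ^- (n.+1 * p) * t.
      apply: (@mulgI _ (a ^+ (n.+1 * p))); apply: (@mulIg _ (a ^+ p)).
      by rewrite !mulgA mulgVK mulgV mul1g mul_t_aX.
    by rewrite -[_ * t * _]mulgA mul_t_aX !mulgA expgS -!mulgA.
  by exists i, p, q, j; rewrite expgSr invgM !mulgA mulgV mul1g.
- move=> [i [p [q [j ->]]]]; case: x; rewrite -/(bs_a _) -/(bs_t _).
    exists i, (n.+1 ^ i + p), q, j; rewrite !mulgA; congr (_ * _ * _).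
    have -> : a^-1 * t ^- i = t ^- i * a ^- (n.+1 ^ i).
      by rewrite -!invgM mul_tX_a.
    by rewrite addnC expgnDr invgM !mulgA.
  by exists i.+1, p, q, j; rewrite expgSr invgM !mulgA.
Qed.

Lemma rho_normal_form i p q j : rho (t ^- i * a ^- p * a ^+ q * t ^+ j) =
  (base ^- i * (q%:R - p%:R), j%:Z - i%:Z)%R.
Proof.
have tX k : rho (t ^+ k) = (0, k%:Z)%R.
  rewrite rhoX rho_t; elim: k => [|k IH] //.
  by rewrite expgS IH affine_mulE /= mulr0 addr0 intS.
have aX k : rho (a ^+ k) = (k%:R, 0)%R by rewrite rhoX rho_a affine_expE.
rewrite !rhoM !rhoV !tX !aX.
rewrite !affine_invE !affine_mulE /= !(oppr0, addr0, mulr0, expr0z, mul1r, add0r).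
by congr pair; rewrite addrC // -mulrDr exprnN.
Qed.

(** Trivial coordinates force [p = q] and [i = j] in the normal form, which then collapses. *)
Lemma rho_inj : injective rho.
Proof.
suff rho_eq1 h : rho h = 1 -> h = 1.
  by move=> x y xy; apply/divg1_eq/rho_eq1; rewrite rhoM rhoV xy mulgV.
have [i [p [q [j ->]]]] := BS1_normal_form h.
rewrite rho_normal_form => -[] /eqP; rewrite mulf_eq0 invr_eq0 expf_eq0.
rewrite (negPf base_neq0) andbF /= subr_eq0 eqr_nat => /eqP -> /eqP.
by rewrite subr_eq0 => /eqP [->]; rewrite mulgVK mulVg.
Qed.

(** The ring Z[1/(n + 1)]. *)
Definition localized (x : rat) := exists i, (base ^+ i * x)%R \is a Num.int.

Lemma rho_localized h : localized (rho h).1.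
Proof.
have [i [p [q [j ->]]]] := BS1_normal_form h; rewrite rho_normal_form /=.
exists i; rewrite mulVKf ?expf_neq0 ?base_neq0 //.
by rewrite rpredB ?natr_int.
Qed.

Lemma rho_surj x k : localized x -> exists h, rho h = (x, k).
Proof.
case=> i /intrP [m xm].
have -> : x = (base ^- i * m%:~R)%R.
  by rewrite -xm mulKf ?expf_neq0 ?base_neq0.
pose p := if m is Negz r then r.+1 else 0.
pose q := if m is Posz r then r else 0.
have -> : (m%:~R = q%:R - p%:R :> rat)%R.
  by rewrite /p /q; case: (m) => r; rewrite ?subr0 ?NegzE ?sub0r ?mulrNz.
pose c := if k is Negz r then r.+1 else 0.
pose d := if k is Posz r then r else 0.
have e : k = (d%:Z - c%:Z)%R by rewrite /c /d; case: (k) => r; rewrite ?NegzE; lia.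
(* The first block maps to [(x, 0)], the second to [(0, k)]. *)
exists (t ^- i * a ^- p * a ^+ q * t ^+ i * (t ^- c * a ^- 0 * a ^+ 0 * t ^+ d)).
rewrite rhoM !rho_normal_form affine_mulE /= !(subrr, mulr0, addr0, add0r).
by rewrite -e.
Qed.

Lemma geom0 : geom 0 = 0%R.
Proof. by rewrite /geom expr0z subrr mul0r. Qed.

Lemma affine_act_a alpha beta : affine_act alpha beta (rho a) = (alpha, 0)%R.
Proof. by rewrite rho_a /affine_act /= geom0 mulr0 addr0 mulr1. Qed.

(** * Endomorphisms in affine coordinates *)

Section Endomorphisms.
Hypothesis n_gt0 : (0 < n)%N.

Lemma base_gt1 : (1 < base)%R.
Proof. by rewrite ltr1n ltnS. Qed.

Lemma base_sub1_neq0 : (base - 1 != 0)%R.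
Proof. by rewrite subr_eq0 gt_eqF ?base_gt1. Qed.

Lemma geom1 : geom 1 = 1%R.
Proof. by rewrite /geom expr1z divff ?base_sub1_neq0. Qed.

Lemma affine_act_t alpha beta : affine_act alpha beta (rho t) = (beta, 1)%R.
Proof. by rewrite rho_t /affine_act /= geom1 mulr0 add0r mulr1. Qed.

Implicit Type phi psi : endo (BS1 n.+1).

Definition endo_scale phi : rat := (rho (phi a)).1.
Definition endo_shift phi : rat := (rho (phi t)).1.

Lemma endo_relation phi : rho (phi t) * rho (phi a) * (rho (phi t))^-1 =
  rho (phi a) ^+ n.+1.
Proof. by rewrite -rhoX -gmulfXn -rhoV -gmulfV -!rhoM -!gmulfM bs_relationE. Qed.

(** By the relation, the exponent k of [phi a] satisfies k = (n + 1) k. *)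
Lemma rho_endo_a phi : rho (phi a) = (endo_scale phi, 0)%R.
Proof.
rewrite [LHS]surjective_pairing; congr pair.
have /(congr1 snd) := endo_relation phi.
rewrite affine_exp2 affine_invE !affine_mulE /=.
move: (rho (phi a)).2 (rho (phi t)).2 => k l; lia.
Qed.

(** First coordinates in the relation give base ^ l * scale = base * scale, with l the exponent of
    [phi t]. *)
Lemma rho_endo_t phi : endo_scale phi != 0%R ->
  rho (phi t) = (endo_shift phi, 1)%R.
Proof.
move=> phi0; rewrite [LHS]surjective_pairing; congr pair.
have := endo_relation phi; rewrite rho_endo_a affine_expE.
rewrite affine_invE !affine_mulE /= addr0 mulrN mulrA -expfzDr ?base_neq0 //.
rewrite subrr expr0z mul1r [X in (X - _)%R]addrC addrK => -[].
rewrite -mulr_natl => /(mulIf phi0) base_l.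
apply: (@ieexprIz _ base); first exact: lt_trans base_gt1.
  by rewrite gt_eqF ?base_gt1.
by rewrite base_l expr1z.
Qed.

Lemma rho_endo2 phi h : (rho (phi h)).2 = ((rho (phi t)).2 * (rho h).2)%R.
Proof.
set l := (rho (phi t)).2.
have E : affine_shift 1%R \o (rho \o phi) =1 affine_shift l \o rho.
  apply: presented_morphism_ext => -[] /=.
    by rewrite -/(bs_a n.+1) rho_endo_a rho_a /affine_shift /= !mulr0.
  by rewrite -/(bs_t n.+1) rho_t /affine_shift /= mul1r mulr1.
by have /(congr1 snd) := E h; rewrite /= mul1r.
Qed.

Lemma rho_endo phi h : (rho (phi t)).2 = 1%R ->
  rho (phi h) = affine_act (endo_scale phi) (endo_shift phi) (rho h).
Proof.
move=> phi_t; pose act := affine_act (endo_scale phi) (endo_shift phi).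
suff: (rho \o phi) =1 (act \o rho) by apply.
apply: presented_morphism_ext => -[] /=.
  by rewrite -/(bs_a n.+1) rho_endo_a affine_act_a.
by rewrite -/(bs_t n.+1) affine_act_t -phi_t -surjective_pairing.
Qed.

Lemma endo_exists alpha beta : localized alpha -> localized beta ->
  exists phi, forall h, rho (phi h) = affine_act alpha beta (rho h).
Proof.
move=> /(rho_surj 0%R) [x rx] /(rho_surj 1%R) [y ry].
pose f z := if z is bs_gen_t then y else x.
have fR u v : bs_relation n.+1 u v -> word_eval f u = word_eval f v.
  have evalX k : word_eval f (nseq k (bs_gen_a, false)) = x ^+ k.
    by elim: k => [|k IH] //=; rewrite expgS IH.
  case=> -> ->; rewrite evalX; apply: rho_inj; rewrite /= !mulg1.
  rewrite rhoX !rhoM rhoV rx ry affine_expE affine_invE !affine_mulE /=; congr pair.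
  rewrite !(addr0, expr1z, expr0z, mulr1, oppr0, mul1r) exprN1.
  by rewrite mulrDr mulrN mulVKf ?base_neq0 // addrC subrK mulr_natl.
pose phi : endo (BS1 n.+1) := presented_lift fR.
have phi_a : rho (phi a) = (alpha, 0)%R by rewrite /phi /= presented_lift_gen.
have phi_t : rho (phi t) = (beta, 1)%R by rewrite /phi /= presented_lift_gen.
exists phi => h; rewrite rho_endo ?phi_t //.
by rewrite /endo_scale /endo_shift phi_a phi_t.
Qed.

(** The exponent of [phi t] is 1: by the relation if the scale is nonzero, and by comparing
    exponents in phi(g) = g if that of [g] is nonzero. Otherwise [phi] kills [a], hence also [g], a
    conjugate of a power of [a]. *)
Lemma rho_e_Stab g phi h : g <> 1 -> e_Stab g phi ->
  rho (phi h) = affine_act (endo_scale phi) (endo_shift phi) (rho h).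
Proof.
move=> g1 phi_g; apply: rho_endo.
have [scale0|/rho_endo_t -> //] := eqVneq (endo_scale phi) 0%R.
have [g0|g0] := eqVneq (rho g).2 0%R; last first.
  by apply: (mulIf g0); rewrite mul1r -rho_endo2 phi_g.
have phi_a : phi a = 1 by apply: rho_inj; rewrite rho_endo_a scale0 rho1.
case: g1; move: g0 phi_g; have [i [p [q [j ->]]]] := BS1_normal_form g.
rewrite rho_normal_form /= /e_Stab /= => /eqP; rewrite subr_eq0 => /eqP [->].
rewrite !gmulfM !gmulfV !gmulfXn phi_a !expg1n invg1 !mulg1 mulVg.
by move=> <-.
Qed.

Lemma endo_scale1 : endo_scale 1 = 1%R.
Proof. by rewrite /endo_scale /= rho_a. Qed.

Lemma endo_shift1 : endo_shift 1 = 0%R.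
Proof. by rewrite /endo_shift /= rho_t. Qed.

Lemma endo_scaleM g phi psi : g <> 1 -> e_Stab g phi ->
  endo_scale (phi * psi) = (endo_scale phi * endo_scale psi)%R.
Proof.
move=> g1 phi_g; transitivity (rho (phi (psi a))).1 => //.
rewrite (rho_e_Stab _ g1 phi_g) rho_endo_a.
by rewrite /= geom0 mulr0 addr0.
Qed.

(** Together with [endo_scaleM]: endomorphisms compose like the maps y |-> scale y + shift. *)
Lemma endo_shiftM g phi psi : g <> 1 -> e_Stab g phi -> e_Stab g psi ->
  endo_shift (phi * psi) = (endo_scale phi * endo_shift psi + endo_shift phi)%R.
Proof.
move=> g1 phi_g psi_g; transitivity (rho (phi (psi t))).1 => //.
rewrite (rho_e_Stab _ g1 phi_g) (rho_e_Stab _ g1 psi_g) affine_act_t.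
by rewrite /= geom1 mulr1.
Qed.

(** * Infinite generation of the stabilisers *)

Lemma localized_nat m : localized m%:R%R.
Proof. by exists 0; rewrite expr0 mul1r natr_int. Qed.

Lemma localized_intM c x : c \is a Num.int -> localized x -> localized (c * x)%R.
Proof. by move=> cZ [i xZ]; exists i; rewrite mulrCA rpredM. Qed.

Lemma e_Stab_endo_exists g alpha beta : localized alpha -> localized beta ->
  affine_act alpha beta (rho g) = rho g ->
  exists phi, [/\ e_Stab g phi, endo_scale phi = alpha & endo_shift phi = beta].
Proof.
move=> alphaL betaL act_g; have [phi phiE] := endo_exists alphaL betaL.
exists phi; split.
- by apply: rho_inj; rewrite phiE.
- by rewrite /endo_scale phiE affine_act_a.
- by rewrite /endo_shift phiE affine_act_t.
Qed.

(* All elements of the stabiliser have scale 1, so the shift identifies it with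
   the additive group Z[1/n.+1], in which a finite set has a common
   denominator. *)
Lemma e_Stab_a_not_finitely_generated g : g <> 1 -> (rho g).2 = 0%R ->
  ~ finitely_generated (e_Stab g).
Proof.
move=> g1 g0; have u0 : (rho g).1 != 0%R.
  apply: contra_notN g1 => /eqP u0; apply: rho_inj.
  by rewrite rho1 [LHS]surjective_pairing u0 g0.
have scale1 phi : e_Stab g phi -> endo_scale phi = 1%R.
  move=> phi_g; have /(congr1 fst) := rho_e_Stab g g1 phi_g.
  rewrite phi_g /= g0 geom0 mulr0 addr0 => scale_u.
  by apply: (mulIf u0); rewrite mul1r -scale_u.
apply: not_finitely_generated => A finA AS.
have [|Q Q_gt0 QA] := finite_common_multiple
  (f := fun phi => `|denq (endo_shift phi)|%N) finA.
  by move=> phi; rewrite absz_gt0 denq_neq0.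
(* Since shifts add, those with denominator dividing [Q] form a submonoid. *)
exists [set phi : endo (BS1 n.+1) | e_Stab g phi /\
  (Q%:R * endo_shift phi)%R \is a Num.int]%classic.
split.
- apply/submonoidE; split=> [|phi psi [phi_g phiQ] [psi_g psiQ]].
    by rewrite /= endo_shift1 mulr0 rpred0.
  split; first by have /submonoidE[_] := e_Stab_submonoid g; apply.
  rewrite (endo_shiftM g1 phi_g psi_g) (scale1 _ phi_g) mul1r mulrDr.
  by rewrite rpredD.
- move=> phi Aphi; split; first exact: AS.
  have /dvdnP [r ->] := QA _ Aphi.
  rewrite -[X in (_ * X)%R]divq_num_den natrM.
  have -> : (`|denq (endo_shift phi)|%:R = (denq (endo_shift phi))%:~R :> rat)%R.
    by rewrite -[in RHS]absz_denq.
  rewrite -mulrA (mulrCA (denq _)%:~R%R) mulfV ?intr_eq0 ?denq_neq0 // mulr1.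
  by rewrite rpredM ?natr_int ?intr_int.
(* The shift [base ^- Q] escapes: Q < base ^ Q, so Q * base ^- Q lies strictly between 0 and 1. *)
- have QL : localized (base ^- Q)%R.
    by exists Q; rewrite divff ?expf_neq0 ?base_neq0.
  have [|phi [phi_g _ phi_Q]] :=
    e_Stab_endo_exists (localized_nat 1) QL (g := g).
    by rewrite [RHS]surjective_pairing /affine_act g0 geom0 mul1r mulr0 addr0.
  move=> /(_ phi phi_g) [_]; rewrite phi_Q.
  have pQ_gt0 : (0 < base ^+ Q)%R by rewrite exprn_gt0 // (lt_trans ltr01 base_gt1).
  move=> /intrP [m E].
  have : (0 < m%:~R :> rat)%R by rewrite -E mulr_gt0 ?invr_gt0 ?ltr0n.
  have : (m%:~R < 1 :> rat)%R.
    by rewrite -E ltr_pdivrMr // mul1r -natrX ltr_nat ltn_expl.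
  by rewrite ltr0z -[1%R]/(1%:~R)%R ltr_int; lia.
Qed.

(* The elements of the stabiliser are determined by their scale, and the scale
   can be an integer 1 + D * Q coprime to all the numerators of finitely many
   given scales. *)
Lemma e_Stab_t_not_finitely_generated g : g <> 1 -> (rho g).2 <> 0%R ->
  ~ finitely_generated (e_Stab g).
Proof.
move=> g1 k0; apply: not_finitely_generated => A finA AS.
(* The value 1 at scale 0 keeps [numer] positive. *)
pose numer phi :=
  if endo_scale phi == 0%R then 1%N else `|numq (endo_scale phi)|%N.
have [|Q Q_gt0 QA] := finite_common_multiple (f := numer) finA.
  move=> phi; rewrite /numer; case: ifP => // /negbT phi0.
  by rewrite absz_gt0 numq_eq0.
(* For a nonzero scale, this says that its numerator divides a power of [Q]. *)
exists [set phi : endo (BS1 n.+1) | e_Stab g phi /\ (endo_scale phi = 0%R \/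
  exists (c : int) r, (endo_scale phi * c%:~R)%R = Q%:R ^+ r)%R]%classic.
split.
- apply/submonoidE; split=> [|phi psi [phi_g phiQ] [psi_g psiQ]].
    split=> //; right; exists 1%R, 0%N; by rewrite endo_scale1 mulr1 expr0.
  split; first by have /submonoidE[_] := e_Stab_submonoid g; apply.
  rewrite (endo_scaleM psi g1 phi_g).
  case: phiQ psiQ => [-> _|[c [r cr]]]; first by left; rewrite mul0r.
  case=> [->|[d [s ds]]]; first by left; rewrite mulr0.
  by right; exists (c * d)%R, (r + s)%N; rewrite intrM mulrACA cr ds exprD.
- move=> phi Aphi; split; first exact: AS.
  have := QA _ Aphi; rewrite /numer; case: eqP => [->|/eqP phi0]; first by left.
  case/dvdnP => r Qr; right.
  (* The denominator clears the fraction; the sign makes the numerator its absolute value. *)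
  exists (denq (endo_scale phi) * sgz (numq (endo_scale phi)) * r%:Z)%R, 1%N.
  rewrite Qr natrM expr1 -{1}[endo_scale phi]divq_num_den !intrM !mulrA.
  rewrite mulfVK ?intr_eq0 ?denq_neq0 // [RHS]mulrC; congr (_ * _)%R.
  by rewrite -intrM pmulrn mulrC -abszEsg.
- set d := (base ^ (rho g).2 - 1)%R.
  have d0 : d != 0%R.
    rewrite subr_eq0; apply/eqP => E; apply: k0.
    apply: (@ieexprIz _ base); first exact: lt_trans base_gt1.
      by rewrite gt_eqF ?base_gt1.
    by rewrite E expr0z.
  (* As [geom (rho g).2] is d / n, the factors [n] and [denq d] clear denominators, [numq d] makes
     the product positive, and [Q] makes 1 + D coprime to [Q]. *)
  pose c : int := (n%:Z * denq d * numq d * Q%:Z)%R.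
  pose D : nat := (`|numq d| ^ 2 * Q)%N.
  have geomc : (geom (rho g).2 * c%:~R = D%:R)%R.
    rewrite /geom -/d -{1}[d]divq_num_den.
    have -> : (base - 1 = n%:R)%R by rewrite /base -addn1 natrD addrK.
    rewrite /c /D !intrM natrM natrX -!pmulrn.
    have -> : (`|numq d|%:R ^+ 2 = (numq d)%:~R ^+ 2 :> rat)%R.
      by rewrite pmulrn abszE intr_norm real_normK ?num_real.
    by field; rewrite intr_eq0 denq_neq0 pnatr_eq0 -lt0n n_gt0.
  have D_gt0 : (0 < D)%N by rewrite muln_gt0 expn_gt0 absz_gt0 numq_eq0 d0.
  have uL : localized ((- c)%:~R * (rho g).1)%R.
    by apply: localized_intM (rho_localized g); exact: intr_int.
  (* The shift [- c * (rho g).1] cancels the excess [D * (rho g).1], so [g] is fixed. *)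
  have [||phi [phi_g phi_D _]] :=
    e_Stab_endo_exists (alpha := (1 + D)%:R%R) _ uL (g := g).
  + exact: localized_nat.
  + rewrite [RHS]surjective_pairing /affine_act; congr pair.
    by rewrite natrD -geomc rmorphN /=; ring.
  move=> /(_ phi phi_g) [_]; rewrite phi_D => -[/eqP|[e [r]]].
    by rewrite pnatr_eq0.
  rewrite pmulrn -intrM -natrX [RHS]pmulrn => /intr_inj /(congr1 absz).
  rewrite abszM !absz_nat => E.
  have : ((1 + D)%N %| Q ^ r)%N by rewrite -E dvdn_mulr.
  (* 1 + D is 1 modulo [Q]; being coprime to Q ^ r and dividing it would force [D = 0]. *)
  have cop : coprime (1 + D) (Q ^ r).
    by apply: coprimeXr; rewrite /D /coprime gcdnC addnC gcdnMDl gcdn1.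
  move=> /gcdn_idPl; move: cop; rewrite /coprime => /eqP ->.
  by case: (D) D_gt0.
Qed.

End Endomorphisms.
End Affine.


Theorem theorem1p4 (n : nat) (n_ge2 : (2 <= n)%N) (g : BS1 n) (g_neq1 : g <> 1) :
  submonoid (e_Stab g) /\ ~ finitely_generated (e_Stab g).
Proof.
split; first exact: e_Stab_submonoid.
case: n n_ge2 g g_neq1 => // n n_ge2 g g_neq1.
have [k0|/eqP k0] := eqVneq (rho g).2 0%R.
  exact: e_Stab_a_not_finitely_generated.
exact: e_Stab_t_not_finitely_generated.
Qed.
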